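(* For $n\geq1$ and a variable $m$, let $$\hat f_n(m)=\sum_{\lambda}\frac{n!}{z_\lambda}\cdot\frac{E_{\lambda_1-1}E_{\lambda_2-1}\cdots}{(\lambda_1-1)!(\lambda_2-1)!\cdots}\cdot m^{\ell(\lambda)},$$ where the sum is over all partitions $\lambda=(\lambda_1,\dots,\lambda_{\ell(\lambda)})$ of $n$ into odd parts. Then, as formal power series in $t$, $$\frac{\hat A_n(t)}{(1-t)^{n+1}}=\sum_{m\geq1}\hat f_n(m)\,t^m.$$
   Context: $E_k$ is the Euler number: the number of up-down permutations $\sigma_1<\sigma_2>\sigma_3<\cdots$ of $[k]$ (so $E_0=1$ and $\sum_k E_kx^k/k!=\tan x+\sec x$). For a partition $\lambda$ with $r_i$ parts equal to $i$, $z_\lambda=\prod_i i^{r_i}r_i!$. For $\sigma\in\mathfrak S_n$, an alternating descent is a position $i\in[n-1]$ such that either $i$ is odd and $\sigma_i>\sigma_{i+1}$, or $i$ is even and $\sigma_i<\sigma_{i+1}$; $\hat d(\sigma)$ is their number, and $\hat A_n(t)=\sum_{\sigma\in\mathfrak S_n}t^{\hat d(\sigma)+1}$. *)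

(* Defs.v *)
From mathcomp Require Import all_boot all_order all_fingroup all_algebra.

Set Implicit Arguments.
Unset Strict Implicit.
Unset Printing Implicit Defensive.

Import GRing.Theory.

(* A permutation s : 'S_n acts on {0, ..., n-1}; the 1-based position of the   *)
(* index i is i.+1, so parities of positions are those of i.+1.                *)

Definition up_down (n : nat) (s : 'S_n) : bool :=
  [forall i : 'I_n, forall j : 'I_n, (j == i.+1 :> nat) ==>
     (if odd i.+1 then s i < s j else s i > s j)].

Definition euler (k : nat) : nat := #|[set s : 'S_k | up_down s]|.

Definition alt_descent (n : nat) (s : 'S_n) (i : 'I_n) : bool :=
  [exists j : 'I_n, (j == i.+1 :> nat) &&
     (if odd i.+1 then s i > s j else s i < s j)].

Definition alt_des (n : nat) (s : 'S_n) : nat := #|[set i | alt_descent s i]|.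

Definition is_partition (n : nat) (la : seq nat) : bool :=
  [&& sorted geq la, all (leq 1) la & sumn la == n].

(* A partition of n has at most n parts, each at most n, which makes the       *)
(* enumeration finite; see mem_odd_partitions and odd_partitions_uniq.         *)
Definition odd_partitions (n : nat) : seq (seq nat) :=
  [seq la <- [seq map val b | b : n.-bseq 'I_n.+1]
     | is_partition n la && all odd la].

Lemma odd_partitions_uniq (n : nat) : uniq (odd_partitions n).
Proof.
apply: filter_uniq; rewrite map_inj_uniq ?enum_uniq // => b c /inj_map eq_bc.
by apply: val_inj; apply: eq_bc; apply: val_inj.
Qed.

Lemma mem_odd_partitions (n : nat) (la : seq nat) :
  (la \in odd_partitions n) = is_partition n la && all odd la.
Proof.
rewrite mem_filter andb_idr // => /andP[/and3P[_ pos_la /eqP sum_la] _].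
have le_la p : p \in la -> p < n.+1.
  move=> p_la; rewrite ltnS -sum_la (perm_sumn (perm_to_rem p_la)) /=.
  exact: leq_addr.
have sz_la : size (map (@inord n) la) <= n.
  rewrite size_map -sum_la; elim: la pos_la {sum_la le_la} => //= p la IHla.
  by case/andP=> p_gt0 /IHla; rewrite -addn1 addnC; apply: leq_add.
apply/mapP; exists (Bseq sz_la); first by rewrite mem_enum.
rewrite /= -map_comp -[LHS]map_id; apply/eq_in_map => p /le_la p_lt /=.
by rewrite inordK.
Qed.

Definition zpart (la : seq nat) : nat :=
  \prod_(1 <= i < (sumn la).+1) (i ^ count_mem i la * (count_mem i la)`!).

Local Open Scope ring_scope.

Definition Ahat (n : nat) : {poly rat} := \sum_(s : 'S_n) 'X^((alt_des s).+1).

Definition fhat (n : nat) : {poly rat} :=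
  \sum_(la <- odd_partitions n)
    ((n`!)%:R / (zpart la)%:R *
     ((\prod_(p <- la) (euler p.-1)%:R) / (\prod_(p <- la) (p.-1)`!%:R)))
    *: 'X^(size la).

(* Formal power series, given by their coefficients.                           *)
Definition fps (R : Type) : Type := nat -> R.

Definition fps_of_poly (R : nzRingType) (p : {poly R}) : fps R :=
  fun k => p`_k.

Definition fps_mul (R : nzRingType) (a b : fps R) : fps R :=
  fun k => \sum_(i < k.+1) a i * b (k - i)%N.

(* The inverse b of a solves b_0 = 1 / a_0 and                                 *)
(* b_k = - (a_1 b_(k-1) + ... + a_k b_0) / a_0 for k > 0.                      *)
Fixpoint fps_inv_coefs (F : fieldType) (a : fps F) (k : nat) : seq F :=
  if k is k'.+1 then
    let bs := fps_inv_coefs a k' in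
    rcons bs (((k' == 0%N)%:R - \sum_(i < k') a i.+1 * bs`_(k' - i.+1)) / a 0%N)
  else [::].

Definition fps_inv (F : fieldType) (a : fps F) : fps F :=
  fun k => (fps_inv_coefs a k.+1)`_k.

Definition fps_div (F : fieldType) (a b : fps F) : fps F :=
  fps_mul a (fps_inv b).

Lemma size_fps_inv_coefs (F : fieldType) (a : fps F) (k : nat) :
  size (fps_inv_coefs a k) = k.
Proof. by elim: k => //= k IHk; rewrite size_rcons IHk. Qed.

Lemma nth_fps_inv_coefs (F : fieldType) (a : fps F) (k i : nat) :
  (i < k)%N -> (fps_inv_coefs a k)`_i = fps_inv a i.
Proof.
elim: k => // k IHk; rewrite ltnS leq_eqVlt => /predU1P[-> // | lt_ik].
by rewrite /= nth_rcons size_fps_inv_coefs lt_ik IHk.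
Qed.

Lemma fps_mulV (F : fieldType) (a : fps F) :
  a 0%N != 0 -> fps_mul a (fps_inv a) =1 fps_of_poly 1.
Proof.
move=> a0 k; rewrite /fps_mul /fps_of_poly coef1 big_ord_recl subn0 /=.
rewrite {1}/fps_inv /= nth_rcons size_fps_inv_coefs ltnn eqxx.
rewrite mulrC divfK //.
rewrite [X in _ - X + _](_ : _ = \sum_(i < k) a i.+1 * fps_inv a (k - i.+1)%N).
  by rewrite subrK.
apply: eq_bigr => i _; rewrite nth_fps_inv_coefs //.
by rewrite ltn_subrL /= (leq_ltn_trans _ (ltn_ord i)).
Qed.

(* Main.v *)
(* Let h(x) be the exponential generating function of the Euler numbers.       *)
(* Cutting a permutation after each of its prefixes without alternating        *)
(* descents gives, with D_n(t) = sum_s t^(d(s)), the recurrence                *)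
(*   D_n = (1-t)^n E_n + sum_(1 <= i <= n) t (1-t)^(i-1) C(n,i) E_i D_(n-i),   *)
(* which says that D_n / (1-t)^(n+1) = sum_m t^m n! [x^n] h(x)^(m+1).          *)
(* Looking at the smallest letter of an up-down permutation gives h' = h h_ev, *)
(* with h_ev the even part of h, so (h^m)' = m h_ev h^m.  The partition sums   *)
(* f_n(m) / n! satisfy the same recurrence in n, by removing one odd part.     *)
Require Import Defs.
From mathcomp Require Import all_boot all_order all_fingroup all_algebra.
From mathcomp Require Import zify ring.

Set Implicit Arguments.
Unset Strict Implicit.
Unset Printing Implicit Defensive.

Import GRing.Theory.
Local Open Scope ring_scope.

(** Both sides have [t^m]-coefficient n! [x^n] h(x)^m for m >= 1. For the left side, the relative
    orders of a prefix and of the complementary suffix of a uniform permutation are independent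
    ([sum_split]). This turns the word identity [descent_word_expansion] into the recurrence
    [egf_alt_des_rec]. Expanding h^(m+2) = h h^(m+1) gives the same recurrence for the series built
    from powers of h ([powers_poly_rec]), and [powers_poly_alt_des] follows by induction. For the
    right side, h' = h h_ev ([egf_euler_rec]) says that log h = sum over odd p of E_(p-1)/(p-1)!
    x^p/p, so the partition sum is the exponential formula for h^m. The proof compares derivatives:
    [egf_fhat_rec] is the equation F' = x h_ev F for the partition sums, and at x = m it has the
    same solution as (h^m)' = m h_ev h^m ([coef_euler_poly_exp]). Series are represented by
    polynomials that are correct up to a chosen order. *)

Definition word_of (n : nat) (s : 'S_n) (j : nat) : nat :=
  oapp (fun i => val (s i)) 0%N (insub j).

Lemma word_ofE (n : nat) (s : 'S_n) (i : 'I_n) : word_of s i = s i.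
Proof. by rewrite /word_of valK. Qed.

Lemma word_of_ord (n : nat) (s : 'S_n) (j : nat) (lt_jn : (j < n)%N) :
  word_of s j = s (Ordinal lt_jn).
Proof. exact: (word_ofE s (Ordinal lt_jn)). Qed.

Lemma word_of_inj (n : nat) (s : 'S_n) (a b : nat) :
  (a < n)%N -> (b < n)%N -> word_of s a = word_of s b -> a = b.
Proof.
move=> lt_a lt_b; rewrite (word_of_ord s lt_a) (word_of_ord s lt_b).
by move=> /val_inj/perm_inj[].
Qed.

(** * Relabelling words and splitting permutations at a position *)

Definition order_invariant (A : Type) (k : nat) (P : (nat -> nat) -> A) : Prop :=
  forall w w', (forall a b, (a < k)%N -> (b < k)%N ->
    (w a < w b)%N = (w' a < w' b)%N) -> P w = P w'.

(** The permutation sends [a] to the rank of [w a] among the values of [w]. *)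
Lemma standardization (k : nat) (w : 'I_k -> nat) : injective w ->
  exists p : 'S_k, forall a b, (p a < p b)%N = (w a < w b)%N.
Proof.
move=> w_inj; pose r a := #|[set b | (w b < w a)%N]|.
have r_lt a b : (w a < w b)%N -> (r a < r b)%N.
  move=> lt_ab; apply: proper_card; apply/properP; split.
    by apply/subsetP=> c; rewrite !inE => /ltn_trans; apply.
  by exists a; rewrite !inE ?ltnn.
have r_ltk a : (r a < k)%N.
  rewrite -[X in (_ < X)%N]card_ord -cardsT; apply: proper_card.
  by apply/properP; split=> //; exists a; rewrite !inE ?ltnn.
have r_mono a b : (r a < r b)%N = (w a < w b)%N.
  case: (ltngtP (w a) (w b)) => [/r_lt //|/r_lt/ltnW|/w_inj->].
    by rewrite leqNgt => /negbTE.
  exact: ltnn.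
have p_inj : injective (fun a => Ordinal (r_ltk a)).
  move=> a b /(congr1 val)/= eq_r; apply: w_inj; apply/eqP.
  by case: ltngtP => // /r_lt; rewrite eq_r ltnn.
by exists (perm p_inj) => a b; rewrite !permE /= r_mono.
Qed.

(** For [P], the word [w \o word_of u] is indistinguishable from that of [u * p], with [p] the
    standardization of [w]; and [u * p] runs over all permutations. *)
Lemma sum_relabel (R : nmodType) (k : nat) (P : (nat -> nat) -> R)
    (w : nat -> nat) :
  order_invariant k P ->
  (forall a b, (a < k)%N -> (b < k)%N -> w a = w b -> a = b) ->
  \sum_(u : 'S_k) P (w \o word_of u) = \sum_(u : 'S_k) P (word_of u).
Proof.
move=> invP w_inj.
have [p pE] : exists p : 'S_k, forall a b, (p a < p b)%N = (w a < w b)%N.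
  by apply: standardization => a b /(w_inj _ _ (ltn_ord a) (ltn_ord b))/val_inj.
rewrite [RHS](reindex_inj (mulIg p)) /=; apply: eq_bigr => u _.
apply: invP => a b lt_a lt_b /=.
by rewrite !(word_of_ord _ lt_a) !(word_of_ord _ lt_b) !permM pE.
Qed.

Section BlockPerm.
Variables (i k : nat) (u : 'S_i) (v : 'S_k).

Definition block_fun (x : 'I_(i + k)) : 'I_(i + k) :=
  match split x with inl a => lshift k (u a) | inr b => rshift i (v b) end.

Lemma block_fun_inj : injective block_fun.
Proof.
apply: can_inj (fun x => match split x with
  inl a => lshift k ((u^-1)%g a) | inr b => rshift i ((v^-1)%g b) end) _ => x.
rewrite /block_fun -[RHS]splitK; case: (split x) => y /=.
  by rewrite -[lshift k (u y)]/(unsplit (inl _)) unsplitK permK.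
by rewrite -[rshift i (v y)]/(unsplit (inr _)) unsplitK permK.
Qed.

Definition block_perm : 'S_(i + k) := perm block_fun_inj.

Lemma word_of_block_l (s : 'S_(i + k)) (a : nat) : (a < i)%N ->
  word_of (block_perm * s)%g a = word_of s (word_of u a).
Proof.
move=> lt_a; rewrite (word_of_ord u lt_a).
rewrite -[X in word_of _ X]/(val (lshift k (Ordinal lt_a))) word_ofE permM permE.
rewrite /block_fun -[lshift k (Ordinal _)]/(unsplit (inl _)) unsplitK.
by rewrite -[X in word_of _ X]/(val (lshift k (u (Ordinal lt_a)))) word_ofE.
Qed.

Lemma word_of_block_r (s : 'S_(i + k)) (b : nat) : (b < k)%N ->
  word_of (block_perm * s)%g (i + b) = word_of s (i + word_of v b).
Proof.
move=> lt_b; rewrite (word_of_ord v lt_b).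
rewrite -[X in word_of _ X]/(val (rshift i (Ordinal lt_b))) word_ofE permM permE.
rewrite /block_fun -[rshift i (Ordinal _)]/(unsplit (inr _)) unsplitK.
by rewrite -[X in word_of _ X]/(val (rshift i (v (Ordinal lt_b)))) word_ofE.
Qed.

End BlockPerm.

(* Permuting the first i and the last k positions among themselves turns the   *)
(* prefix and the suffix of a fixed s into all their rearrangements.           *)
Lemma sum_split (R : comNzRingType) (n i k : nat) (P Q : (nat -> nat) -> R) :
  (i + k = n)%N -> order_invariant i P -> order_invariant k Q ->
  (i`! * k`!)%:R *
      (\sum_(s : 'S_n) P (word_of s) * Q (fun j => word_of s (i + j)%N)) =
  n`!%:R * ((\sum_(u : 'S_i) P (word_of u)) * (\sum_(v : 'S_k) Q (word_of v))).
Proof.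
move=> <- {n} invP invQ; 
pose F (s : 'S_(i + k)) := P (word_of s) * Q (fun j => word_of s (i + j)%N).
rewrite -[X in _ * X]/(\sum_s F s).
(* Left multiplication by a block permutation only reindexes the sum over [s], so this triple sum is
   i! k! copies of the original one. *)
transitivity (\sum_(u : 'S_i) \sum_(v : 'S_k)
    \sum_(s : 'S_(i + k)) F (block_perm u v * s)%g).
  have sumF u v : \sum_s F (block_perm u v * s)%g = \sum_s F s.
    by rewrite [RHS](reindex_inj (mulgI (block_perm u v))).
  under [RHS]eq_bigr do [under eq_bigr do rewrite sumF; rewrite sumr_const card_Sn].
  by rewrite sumr_const card_Sn -mulrnA mulr_natl mulnC.
under eq_bigr do rewrite exchange_big /=; rewrite exchange_big /=.
transitivity (\sum_(s : 'S_(i + k)) (\sum_(u : 'S_i) P (word_of u)) *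
    (\sum_(v : 'S_k) Q (word_of v))); last first.
  by rewrite sumr_const card_Sn mulr_natl.
apply: eq_bigr => s _.
have w_inj a b : (a < i)%N -> (b < i)%N -> word_of s a = word_of s b -> a = b.
  by move=> lt_a lt_b /word_of_inj; apply; apply: ltn_addr.
rewrite -(sum_relabel invP w_inj).
have w_inj' a b : (a < k)%N -> (b < k)%N ->
    word_of s (i + a) = word_of s (i + b) -> a = b.
  move=> lt_a lt_b eq_w; apply: (@addnI i).
  by apply: word_of_inj eq_w; rewrite ltn_add2l.
rewrite -(sum_relabel (w := fun j => word_of s (i + j)%N) invQ w_inj').
rewrite mulr_suml; apply: eq_bigr => u _; rewrite mulr_sumr; apply: eq_bigr => v _.
congr (_ * _); [apply: invP | apply: invQ] => a b lt_a lt_b /=.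
  by rewrite !word_of_block_l.
by rewrite !word_of_block_r.
Qed.

(** * Alternating descents as words of bits *)

Definition alt_bit (b : bool) (w : nat -> nat) (j : nat) : bool :=
  (w j.+1 < w j)%N (+) odd j (+) b.

Definition alt_bits (b : bool) (k : nat) (w : nat -> nat) : seq bool :=
  [seq alt_bit b w j | j <- iota 0 k.-1].

Lemma size_alt_bits (b : bool) (k : nat) (w : nat -> nat) :
  size (alt_bits b k w) = k.-1.
Proof. by rewrite size_map size_iota. Qed.

Lemma alt_bits_invariant (A : Type) (b : bool) (k : nat) (G : seq bool -> A) :
  order_invariant k (fun w => G (alt_bits b k w)).
Proof.
move=> w w' eq_ww'; congr (G _); apply/eq_in_map => j; rewrite mem_iota => lt_j.
by rewrite /alt_bit eq_ww' //; lia.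
Qed.

Lemma take_alt_bits (b : bool) (n i : nat) (w : nat -> nat) : (i < n)%N ->
  take i (alt_bits b n w) = alt_bits b i.+1 w.
Proof. by move=> lt_in; rewrite -map_take take_iota (minn_idPl _) //; lia. Qed.

(** A suffix starting at an odd index sees all parities exchanged; the flag [b] exists to record
    this. *)
Lemma drop_alt_bits (b : bool) (n i : nat) (w : nat -> nat) :
  drop i (alt_bits b n w) = alt_bits (odd i (+) b) (n - i) (fun j => w (i + j)%N).
Proof.
rewrite -map_drop drop_iota add0n -[X in iota X]addn0 iotaDl -map_comp.
rewrite /alt_bits (_ : n.-1 - i = (n - i).-1)%N; last by lia.
apply: eq_map => j /=; rewrite /alt_bit addnS oddD.
by rewrite [odd i (+) odd j]addbC !addbA.
Qed.

Lemma alt_descentE (n : nat) (s : 'S_n) (i : 'I_n) :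
  alt_descent s i = (i.+1 < n)%N && alt_bit false (word_of s) i.
Proof.
apply/existsP/andP=> [[j /andP[/eqP eq_j des_ij]]|[lt_i des_i]].
  have lt_i : (i.+1 < n)%N by rewrite -eq_j.
  split=> //; rewrite /alt_bit addbF -eq_j !word_ofE; move: des_ij => /=.
  case: (odd i) => /=; last by rewrite addbF.
  by rewrite addbT -leqNgt => /ltnW.
exists (Ordinal lt_i); rewrite eqxx /=; move: des_i.
rewrite /alt_bit addbF (word_of_ord s lt_i) word_ofE.
case: (odd i) => /=; last by rewrite addbF.
rewrite addbT -leqNgt leq_eqVlt => /predU1P[|//].
by move=> /val_inj/perm_inj/(congr1 val)/n_Sn.
Qed.

Lemma alt_desE (n : nat) (s : 'S_n) :
  alt_des s = count id (alt_bits false n (word_of s)).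
Proof.
pose p j := (j.+1 < n)%N && alt_bit false (word_of s) j.
(* [alt_des] ranges over all [n] indices, but the last one has no successor, hence no bit. *)
have -> : alt_des s = count p (iota 0 n).
  rewrite -val_enum_ord count_map /alt_des cardE size_filter enumT.
  by apply: eq_count => i; rewrite /= inE alt_descentE.
rewrite /alt_bits count_map /p {p}; move: (word_of s) => w.
case: n {s} => // n.
have -> : iota 0 n.+1 = iota 0 n ++ [:: n] by rewrite -addn1 iotaD.
rewrite count_cat /= ltnn !addn0.
by apply: eq_in_count => j; rewrite mem_iota ltnS => /andP[_ ->].
Qed.

Lemma up_downE (n : nat) (s : 'S_n) :
  up_down s = ~~ has id (alt_bits false n (word_of s)).
Proof.
rewrite has_count -alt_desE -leqNgt leqn0 /alt_des cards_eq0.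
apply/idP/eqP => [/forallP ud_s|des_s].
  apply/setP=> i; rewrite !inE; apply/negbTE/existsP=> -[j /andP[eq_j]].
  have /forallP/(_ j) := ud_s i; rewrite eq_j /=.
  by case: ifP => _; rewrite ltnNge => /negP lt /ltnW.
apply/forallP=> i; apply/forallP=> j; apply/implyP=> eq_j.
have /negbT : (i \in set0) = false by rewrite inE.
rewrite -des_s inE negb_exists => /forallP/(_ j); rewrite eq_j /=.
have ne_ij : s i != s j :> nat.
  by apply/eqP=> /val_inj/perm_inj eq_ij; move: eq_j; rewrite eq_ij ltn_eqF.
by case: ifP => _; rewrite -leqNgt leq_eqVlt ?(negPf ne_ij) // eq_sym (negPf ne_ij).
Qed.

(** Reversing the values of a permutation flips every comparison, which cancels the flag. *)
Lemma sum_alt_bits_compl (R : nmodType) (n : nat) (G : seq bool -> R) (b : bool) :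
  \sum_(s : 'S_n) G (alt_bits b n (word_of s)) =
  \sum_(s : 'S_n) G (alt_bits false n (word_of s)).
Proof.
case: b => //; pose r : 'S_n := perm (@rev_ord_inj n).
rewrite [LHS](reindex_inj (mulIg r)) /=; apply: eq_bigr => s _; congr (G _).
apply/eq_in_map => j; rewrite mem_iota => /= lt_j.
have [lt0 lt1] : (j < n)%N /\ (j.+1 < n)%N by lia.
rewrite /alt_bit !(word_of_ord _ lt0) !(word_of_ord _ lt1) !permM !permE /=.
have /eqP : s (Ordinal lt0) != s (Ordinal lt1) :> nat.
  by rewrite val_eqE (inj_eq perm_inj) -val_eqE /= ltn_eqF.
move: (s _) (s _) => [x lt_x] [y lt_y] /= ne_xy.
rewrite addbT addbF -addNb; congr (_ (+) _); lia.
Qed.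

(** * Recurrence for the alternating descent polynomials *)

Definition egf_euler (k : nat) : rat := (euler k)%:R / k`!%:R.

Definition egf_alt_des (n : nat) : {poly rat} :=
  (n`!%:R)^-1 *: \sum_(s : 'S_n) 'X^(alt_des s).

Lemma fact_neq0 (F : numFieldType) (n : nat) : n`!%:R != 0 :> F.
Proof. by rewrite Num.Theory.pnatr_eq0 -lt0n fact_gt0. Qed.

Lemma sum_no_descent (R : pzSemiRingType) (k : nat) :
  \sum_(s : 'S_k) (~~ has id (alt_bits false k (word_of s)))%:R =
  (euler k)%:R :> R.
Proof.
rewrite /euler -sum1dep_card natr_sum [RHS]big_mkcond /=.
by apply: eq_bigr => s _; rewrite -up_downE; case: up_down.
Qed.

(* By induction on the word, as t + [~~ c] (1 - t) = t ^ c for a bit c.        *)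
Lemma descent_word_expansion (R : comNzRingType) (t : R) (cs : seq bool) :
  t ^+ count id cs =
    (~~ has id cs)%:R * (1 - t) ^+ (size cs).+1 +
    \sum_(i < (size cs).+1)
      t * (1 - t) ^+ i * ((~~ has id (take i cs))%:R * t ^+ count id (drop i.+1 cs)).
Proof.
elim: cs => [|c cs IHcs]; first by rewrite big_ord1 /= !expr0 !expr1; ring.
rewrite big_ord_recl /= drop0 expr0 exprD.
case: c => /=.
  by rewrite big1 => [|i _]; rewrite ?mul0r ?mulr0 // expr1 mulr1 mul1r add0r addr0.
under [X in _ + (_ + X)]eq_bigr do
  rewrite [bump 0 _]add1n exprS [t * _]mulrCA -mulrA.
rewrite -mulr_sumr /= expr0 !mul1r !mulr1 (exprS _ (size cs).+1) mulrCA.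
by rewrite addrCA -mulrDr -IHcs -mulrDl addrC subrK mul1r.
Qed.

(** Summing [descent_word_expansion] over permutations, term [i] pairs a descent-free prefix of i+1
    letters with a free suffix; the bit at the cut has disappeared. The binomial coefficient from
    [sum_split] is absorbed by the factorials. *)
Lemma egf_alt_des_rec (n : nat) : (0 < n)%N ->
  egf_alt_des n = (egf_euler n)%:P * (1 - 'X) ^+ n +
    \sum_(i < n) 'X * (1 - 'X) ^+ i *
      ((egf_euler i.+1)%:P * egf_alt_des (n - i.+1)).
Proof.
move=> n_gt0; set t : {poly rat} := 'X.
apply: (scalerI (fact_neq0 _ n)); rewrite {1}/egf_alt_des scalerA.
rewrite divff ?fact_neq0 // scale1r.
under eq_bigr do rewrite alt_desE descent_word_expansion size_alt_bits prednK //.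
rewrite big_split /= exchange_big /= scalerDr; congr (_ + _).
  rewrite -mulr_suml sum_no_descent scalerAl -mul_polyC -polyCM /egf_euler.
  by rewrite [_ * (_ / _)]mulrC divfK ?fact_neq0 // polyC_natr.
rewrite scaler_sumr; apply: eq_bigr => i _.
rewrite -mulr_sumr scalerAr; congr (_ * _).
have [lt_in ik] : (i < n)%N /\ (i.+1 + (n - i.+1) = n)%N.
  by have := ltn_ord i; lia.
apply: (scalerI (a := (i.+1`! * (n - i.+1)`!)%:R)).
  by rewrite natrM mulf_neq0 ?fact_neq0.
under eq_bigr do rewrite take_alt_bits // drop_alt_bits.
rewrite scaler_nat -[LHS]mulr_natl; set b := odd i.+1 (+) false.
have /= -> := sum_split ik
  (alt_bits_invariant false (fun cs => (~~ has id cs)%:R : {poly rat}))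
  (alt_bits_invariant b (fun cs => t ^+ count id cs)).
rewrite sum_no_descent (sum_alt_bits_compl _ (fun cs => t ^+ count id cs)).
rewrite /egf_alt_des /egf_euler natrM mulr_natl -scaler_nat.
rewrite [RHS]scalerA [X in _ = X *: _]mulrC -[RHS]scalerA; congr (_ *: _).
rewrite -scalerAr scalerA -mul_polyC mulrA -polyCM -polyC_natr.
under eq_bigr do rewrite -alt_desE.
congr (_%:P * _); field.
by rewrite !fact_neq0.
Qed.

(** * The differential equation for the Euler numbers *)

Lemma no_descentP (b : bool) (k : nat) (w : nat -> nat) :
  reflect (forall j, (j.+1 < k)%N -> ~~ alt_bit b w j) (~~ has id (alt_bits b k w)).
Proof.
rewrite /alt_bits has_map; apply: (iffP hasPn) => bits0 j.
  by move=> lt_j; apply: bits0; rewrite mem_iota; lia.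
by rewrite mem_iota => lt_j; apply: bits0; lia.
Qed.

(** The bits on either side of the minimum, at index [i], both equal [odd i]. Beyond it, indices are
    shifted by one, so the suffix is tested with the opposite flag. *)
Lemma no_descent_lift_perm (n : nat) (i : 'I_n.+1) (s : 'S_n) :
  ~~ has id (alt_bits false n.+1 (word_of (lift_perm i ord0 s))) =
  [&& ~~ odd i, ~~ has id (alt_bits false i (word_of s)) &
      ~~ has id (alt_bits true (n - i) (fun j => word_of s (i + j)%N))].
Proof.
set w' := word_of (lift_perm _ _ _); set w := word_of s.
have w'i : w' i = 0%N by rewrite /w' word_ofE lift_perm_id.
have w'_bump j : (j < n)%N -> w' (bump i j) = (w j).+1.
  move=> lt_j; rewrite /w (word_of_ord s lt_j) /w'.
  by rewrite -[bump i j]/(val (lift i (Ordinal lt_j))) word_ofE lift_perm_lift.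
have w'_lt j : (j < i)%N -> w' j = (w j).+1.
  move=> lt_ji; rewrite -w'_bump; last by have := ltn_ord i; lia.
  by rewrite /bump leqNgt lt_ji.
have w'_ge j : (i <= j < n)%N -> w' j.+1 = (w j).+1.
  by case/andP=> le_ij lt_jn; rewrite -w'_bump // /bump le_ij.
have bit_lt j : (j.+1 < i)%N -> alt_bit false w' j = alt_bit false w j.
  by move=> lt_ji; rewrite /alt_bit !w'_lt // ltnW.
have bit_pred j : j.+1 = i -> alt_bit false w' j = odd i.
  move=> eq_j; rewrite /alt_bit eq_j w'i w'_lt; last by rewrite -eq_j.
  by rewrite addbF -eq_j.
have bit_min : (i < n)%N -> alt_bit false w' i = odd i.
  by move=> lt_in; rewrite /alt_bit w'i ltn0 addbF.
have bit_gt j : (j.+1 < n - i)%N -> alt_bit false w' (i + j).+1 =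
    odd i (+) alt_bit true (fun j => w (i + j)%N) j.
  by move=> lt_j; rewrite /alt_bit !w'_ge ?ltnS ?addnS /=; lia.
apply/no_descentP/and3P => [bits0|[ev_i /no_descentP bits_l /no_descentP bits_r] j].
  have ev_i : ~~ odd i.
    have [-> //|i_gt0] := posnP i.
    by rewrite -(bit_pred i.-1) ?bits0 ?prednK.
  split=> //; apply/no_descentP => j lt_j.
    by rewrite -bit_lt // bits0 //; have := ltn_ord i; lia.
  have /bits0 : ((i + j).+2 < n.+1)%N by lia.
  by rewrite bit_gt // (negbTE ev_i).
rewrite ltnS => lt_j; have [lt_ji|gt_ji|eq_ji] := ltngtP j.+1 i.
- by rewrite bit_lt // bits_l.
- move: gt_ji; rewrite ltnS leq_eqVlt => /predU1P[eq_ij|gt_ji].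
    by rewrite -eq_ij bit_min // eq_ij.
  have lt_k : ((j - i.+1).+1 < n - i)%N by lia.
  by rewrite (_ : j = (i + (j - i.+1)).+1) ?bit_gt ?(negbTE ev_i) ?bits_r //; lia.
- by rewrite bit_pred.
Qed.

Lemma sum_lift_perm (R : nmodType) (n : nat) (F : 'S_n.+1 -> R) :
  \sum_(s : 'S_n.+1) F s = \sum_(i : 'I_n.+1) \sum_(s : 'S_n) F (lift_perm i ord0 s).
Proof.
rewrite pair_big /= (reindex (fun p => lift_perm p.1 ord0 p.2)) //=.
apply: onW_bij; apply: inj_card_bij => [[i s] [i' s'] /= eq_l|]; last first.
  by rewrite card_prod card_ord !card_Sn factS.
have eq_i : i = i'.
  by apply: (@perm_inj _ (lift_perm i ord0 s)); rewrite {2}eq_l !lift_perm_id.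
move: eq_l; rewrite -{}eq_i => eq_l; congr (_, _); apply/permP=> x.
by apply: (@lift_inj _ ord0); rewrite -!(lift_perm_lift i) eq_l.
Qed.

(* The smallest letter of an up-down word stands at an odd (1-based) position, *)
(* after an up-down word of even length and before a down-up word.             *)
Lemma egf_euler_rec (n : nat) :
  n.+1%:R * egf_euler n.+1 =
    \sum_(j < n.+1) (~~ odd j)%:R * (egf_euler j * egf_euler (n - j)).
Proof.
apply: (mulfI (fact_neq0 _ n)); rewrite mulrA -natrM mulnC -factS /egf_euler.
rewrite [LHS]mulrC divfK ?fact_neq0 // -sum_no_descent sum_lift_perm mulr_sumr.
apply: eq_bigr => i _; have le_in : (i + (n - i) = n)%N.
  by have := ltn_ord i; lia.
under eq_bigr do rewrite no_descent_lift_perm -!mulnb !natrM.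
rewrite -mulr_sumr [RHS]mulrCA; congr (_ * _).
apply: (mulfI (_ : (i`! * (n - i)`!)%:R != 0)).
  by rewrite natrM mulf_neq0 ?fact_neq0.
have /= -> := sum_split le_in
  (alt_bits_invariant false (fun cs => (~~ has id cs)%:R : rat))
  (alt_bits_invariant true (fun cs => (~~ has id cs)%:R)).
rewrite (sum_alt_bits_compl _ (fun cs => (~~ has id cs)%:R) true).
rewrite !sum_no_descent natrM.
by field; rewrite !fact_neq0.
Qed.

(** * Partition sums and removal of one part *)

Lemma zpart_widen (la : seq nat) (N : nat) : (sumn la < N)%N ->
  zpart la = (\prod_(1 <= i < N) (i ^ count_mem i la * (count_mem i la)`!))%N.
Proof.
move=> lt_N; rewrite [RHS](@big_cat_nat _ _ _ (sumn la).+1) //=.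
rewrite [X in (_ * X)%N]big_nat_cond [X in (_ * X)%N]big1 ?muln1 // => i.
rewrite andbT => /andP[lt_i _]; have -> // : count_mem i la = 0%N.
apply/count_memPn; apply: contraL lt_i => i_la; rewrite -leqNgt.
by rewrite (perm_sumn (perm_to_rem i_la)) leq_addr.
Qed.

(** One more copy of [p] contributes a factor [p] to the power and the new multiplicity to the
    factorial. *)
Lemma zpart_perm_cons (la mu : seq nat) (p : nat) :
  (0 < p)%N -> perm_eq la (p :: mu) ->
  zpart la = (p * (count_mem p la) * zpart mu)%N.
Proof.
move=> p_gt0 eq_la.
have sum_la : sumn la = (p + sumn mu)%N := perm_sumn eq_la.
have ct i : count_mem i la = ((p == i) + count_mem i mu)%N.
  by move/seq.permP: eq_la => /(_ (pred1 i)).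
rewrite (@zpart_widen mu (sumn la).+1) ?sum_la ?ltnS ?leq_addl // /zpart.
rewrite sum_la !(@bigD1_seq _ _ _ _ _ p) ?iota_uniq ?mem_index_iota ?p_gt0 //=;
  try by rewrite ltnS leq_addr.
rewrite !ct eqxx add1n factS expnS.
set A := (\prod_(_ <- _ | _) _)%N; set B := (\prod_(_ <- _ | _) _)%N.
suff -> : A = B by ring.
by apply: eq_bigr => i ne_ip; rewrite ct eq_sym (negbTE ne_ip).
Qed.

Lemma sumn_count (la : seq nat) (N : nat) : all (gtn N) la ->
  (\sum_(i < N) i * count_mem (i : nat) la)%N = sumn la.
Proof.
elim: la => [|p la IHla] /=; first by rewrite big1 // => i _; rewrite muln0.
case/andP=> lt_p /IHla <-; under eq_bigr do rewrite mulnDr.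
rewrite big_split /= (bigD1 (Ordinal lt_p)) //= eqxx muln1 big1 ?addn0 // => i.
by rewrite -val_eqE /= eq_sym => /negbTE->; rewrite muln0.
Qed.

Lemma geq_trans : transitive geq.
Proof. by move=> a b c ba ac; apply: leq_trans ac ba. Qed.

Lemma geq_anti : antisymmetric geq.
Proof. by move=> a b; rewrite andbC -eqn_leq => /eqP. Qed.

Lemma geq_total : total geq.
Proof. by move=> a b; apply: leq_total. Qed.

(** Deleting one copy of [p] is a bijection; its inverse inserts [p] and sorts again. *)
Lemma odd_partitions_with_part (n p : nat) : odd p -> (p <= n)%N ->
  perm_eq [seq la <- odd_partitions n | p \in la]
          [seq sort geq (p :: mu) | mu <- odd_partitions (n - p)].
Proof.
move=> odd_p le_pn; have p_gt0 : (0 < p)%N by case: p odd_p {le_pn}.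
apply: uniq_perm.
- by rewrite filter_uniq // odd_partitions_uniq.
- rewrite map_inj_in_uniq ?odd_partitions_uniq // => mu mu'.
  rewrite !mem_odd_partitions => /andP[/and3P[mu_s _ _] _].
  move=> /andP[/and3P[mu'_s _ _] _] /perm_sortP-/(_ geq_total geq_trans geq_anti).
  rewrite perm_cons; exact: sorted_eq geq_trans geq_anti _ _ mu_s mu'_s.
move=> la; apply/idP/mapP => [|[mu]].
  rewrite mem_filter mem_odd_partitions => /andP[p_la].
  case/andP=> /and3P[la_s la_pos /eqP sum_la] la_odd.
  have eq_la := perm_to_rem p_la; exists (rem p la).
    rewrite mem_odd_partitions /is_partition.
    rewrite (subseq_sorted geq_trans (rem_subseq p la) la_s) /=.
    move: la_pos la_odd; rewrite !(perm_all _ eq_la) => /= /andP[_ ->] /andP[_ ->].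
    by rewrite -sum_la (perm_sumn eq_la) /= addKn eqxx.
  apply: (sorted_eq geq_trans geq_anti) => //; first exact: sort_sorted geq_total _.
  by rewrite perm_sym perm_sort perm_sym.
rewrite mem_odd_partitions => /andP[/and3P[mu_s mu_pos /eqP sum_mu] mu_odd] ->.
rewrite mem_filter mem_odd_partitions /is_partition mem_sort mem_head.
rewrite (sort_sorted geq_total) !all_sort /= p_gt0 odd_p mu_pos mu_odd.
by rewrite (perm_sumn (permEl (perm_sort geq (p :: mu)))) /= sum_mu subnKC ?eqxx.
Qed.

Definition partition_weight (x : rat) (la : seq nat) : rat :=
  (\prod_(p <- la) (x * egf_euler p.-1)) / (zpart la)%:R.

Definition egf_fhat (x : rat) (n : nat) : rat :=
  \sum_(la <- odd_partitions n) partition_weight x la.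

Lemma zpart_gt0 (la : seq nat) : (0 < zpart la)%N.
Proof.
rewrite /zpart big_nat_cond; apply: prodn_cond_gt0 => i /andP[/andP[i_gt0 _] _].
by rewrite muln_gt0 expn_gt0 i_gt0 fact_gt0.
Qed.

Lemma horner_fhat (x : rat) (n : nat) : (fhat n).[x] = n`!%:R * egf_fhat x n.
Proof.
rewrite /fhat horner_sum mulr_sumr; apply: eq_bigr => la _.
rewrite hornerZ hornerXn /partition_weight big_split /=.
rewrite big_const_seq count_predT iter_mulr_1.
rewrite /egf_euler prodf_div; ring.
Qed.

(** Write n+1 as the sum of p times the multiplicity of p in [la], and exchange sums. By
    [zpart_perm_cons], that factor cancels against [zpart la] when a part p = j+1 is removed,
    leaving x E_j/j! times the weight of the rest. *)
Lemma egf_fhat_rec (x : rat) (n : nat) :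
  n.+1%:R * egf_fhat x n.+1 =
    x * \sum_(j < n.+1) (~~ odd j)%:R * (egf_euler j * egf_fhat x (n - j)).
Proof.
transitivity (\sum_(la <- odd_partitions n.+1) \sum_(i < n.+2)
    (i * count_mem (i : nat) la)%:R * partition_weight x la).
  rewrite mulr_sumr big_seq [RHS]big_seq; apply: eq_bigr => la.
  rewrite mem_odd_partitions => /andP[/and3P[_ _ /eqP sum_la] _].
  rewrite -mulr_suml -natr_sum sumn_count ?sum_la //; apply/allP=> p p_la.
  by rewrite /= ltnS -sum_la (perm_sumn (perm_to_rem p_la)) leq_addr.
rewrite exchange_big big_ord_recl /= big1 ?add0r => [|la _]; last first.
  by rewrite mul0n mul0r.
rewrite mulr_sumr; apply: eq_bigr => j _; rewrite /bump leq0n add1n.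
case: (boolP (odd j)) => [odd_j|ev_j]; last first.
  rewrite mul1r (bigID (fun la : seq nat => j.+1 \in la)) /=.
  rewrite [X in _ + X]big1 => [|la]; last first.
    by move/count_memPn->; rewrite muln0 mul0r.
  rewrite addr0 -big_filter.
  have lt_j : (j.+1 <= n.+1)%N by [].
  rewrite (perm_big _ (odd_partitions_with_part _ lt_j)) // big_map subSS.
  rewrite /egf_fhat !mulr_sumr; apply: eq_bigr => mu _.
  have eq_la := permEl (perm_sort geq (j.+1 :: mu)).
  rewrite /partition_weight (zpart_perm_cons _ eq_la) // (perm_big _ eq_la) /=.
  rewrite big_cons /= !natrM; field.
  rewrite !Num.Theory.pnatr_eq0 -!lt0n zpart_gt0 -has_count has_pred1 mem_sort.
  by rewrite mem_head nat1r Num.Theory.pnatr_eq0.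
rewrite mul0r mulr0 big_seq big1 // => la.
rewrite mem_odd_partitions => /andP[_ /allP la_odd].
rewrite (count_memPn _) ?muln0 ?mul0r //; apply/negP=> /la_odd /=.
by rewrite odd_j.
Qed.

(** * Powers of the Euler series *)

Lemma eq_coef_mul (R : nzRingType) (M : nat) (p q q' : {poly R}) :
  (forall j, (j < M)%N -> q`_j = q'`_j) ->
  forall m, (m < M)%N -> (p * q)`_m = (p * q')`_m.
Proof.
move=> eq_q m lt_m; rewrite !coefM; apply: eq_bigr => j _.
by rewrite eq_q //; lia.
Qed.

Lemma egf_euler0 : egf_euler 0 = 1.
Proof.
by rewrite /egf_euler -sum_no_descent sumr_const card_Sn fact0 divr1.
Qed.

Lemma egf_alt_des0 : egf_alt_des 0 = 1.
Proof.
rewrite /egf_alt_des; under eq_bigr do rewrite alt_desE /= expr0.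
by rewrite sumr_const card_Sn fact0 invr1 scale1r.
Qed.

Lemma egf_fhat0 (x : rat) : egf_fhat x 0 = 1.
Proof.
rewrite /egf_fhat; have -> : odd_partitions 0 = [:: [::]].
  apply: perm_small_eq => //; apply: uniq_perm => // [|la].
    exact: odd_partitions_uniq.
  rewrite mem_odd_partitions inE; apply/idP/eqP => [|-> //].
  case: la => // p la /andP[/and3P[_ /= /andP[p_gt0 _]]].
  by rewrite addn_eq0 eqn0Ngt p_gt0.
rewrite big_seq1 /partition_weight big_nil.
by rewrite /zpart big_geq // divr1.
Qed.

Definition euler_poly (N : nat) : {poly rat} := \poly_(j < N) egf_euler j.

(** Both sides start at 1 and satisfy the same first-order recurrence in [k]. *)
Lemma coef_euler_poly_exp (N k m : nat) : (k < N)%N ->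
  ((euler_poly N) ^+ m)`_k = egf_fhat m%:R k.
Proof.
set H := euler_poly N; elim/ltn_ind: k => -[|k] IHk lt_kN.
  rewrite egf_fhat0 -horner_coef0 horner_exp horner_coef0 coef_poly lt_kN.
  by rewrite egf_euler0 expr1n.
(* The truncated even part h_ev. *)
pose He : {poly rat} := \poly_(j < N) ((~~ odd j)%:R * egf_euler j).
have derivH j : (j < k.+1)%N -> H^`()`_j = (H * He)`_j.
  move=> lt_jk; have lt_jN : (j.+1 < N)%N by lia.
  rewrite coef_deriv coef_poly lt_jN -mulr_natl egf_euler_rec mulrC coefM.
  apply: eq_bigr => i _; have lt_ij := ltn_ord i.
  by rewrite !coef_poly !ifT ?mulrA //; lia.
apply: (mulfI (_ : k.+1%:R != 0)); first by rewrite Num.Theory.pnatr_eq0.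
rewrite egf_fhat_rec mulr_natl -coef_deriv deriv_exp coefMn -[LHS]mulr_natl.
case: m => [|m] in IHk *; first by rewrite !mul0r.
congr (_ * _); rewrite mulrC.
rewrite (eq_coef_mul (q' := H * He) _ derivH) // mulrA -exprSr mulrC coefM.
apply: eq_bigr => j _; have := ltn_ord j; rewrite ltnS => le_jk.
by rewrite coef_poly ifT ?IHk ?mulrA //; lia.
Qed.

Section PowersSeries.
Variables N M : nat.
Let H := euler_poly N.

(* The t-series with m-th coefficient [x^k] h(x)^(m+1), up to order M. *)
Definition powers_poly (k : nat) : {poly rat} := \poly_(m < M) (H ^+ m.+1)`_k.

(** In the coefficient of x^k in h h^(m+1), the term with E_0 = 1 is the previous coefficient, which
    multiplication by 1 - t subtracts. *)
Lemma powers_poly_rec (k m : nat) : (k < N)%N -> (m < M)%N ->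
  ((1 - 'X) * powers_poly k)`_m =
  ((egf_euler k)%:P +
     'X * \sum_(i < k) (egf_euler i.+1)%:P * powers_poly (k - i.+1))`_m.
Proof.
move=> lt_kN lt_mM; rewrite mulrBl mul1r coefB coefD coefC !coefXM coef_poly lt_mM.
case: m lt_mM => [|m] lt_mM /=; first by rewrite expr1 coef_poly lt_kN subr0.
rewrite add0r coef_poly ifT; last by lia.
rewrite [H ^+ m.+2]exprS [(H * H ^+ m.+1)`_k]coefM big_ord_recl subn0.
rewrite [H`_ord0]coef_poly (leq_trans _ lt_kN) //.
rewrite egf_euler0 mul1r addrC addKr coef_sum; apply: eq_bigr => i _.
rewrite coefCM !coef_poly lift0 !ifT //; first lia.
by have := ltn_ord i; lia.
Qed.

(** Multiplying [powers_poly_rec] by (1-t)^k reproduces [egf_alt_des_rec], term by term. *)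
Lemma powers_poly_alt_des (k m : nat) : (k < N)%N -> (m < M)%N ->
  ((1 - 'X) ^+ k.+1 * powers_poly k)`_m = (egf_alt_des k)`_m.
Proof.
elim/ltn_ind: k m => k IHk m lt_kN lt_mM.
rewrite exprSr -mulrA.
rewrite (eq_coef_mul _ (fun j => @powers_poly_rec k j lt_kN)) //.
have -> : egf_alt_des k = (egf_euler k)%:P * (1 - 'X) ^+ k +
    \sum_(i < k) 'X * (1 - 'X) ^+ i *
      ((egf_euler i.+1)%:P * egf_alt_des (k - i.+1)).
  case: k {IHk lt_kN} => [|k]; last exact: egf_alt_des_rec.
  by rewrite egf_alt_des0 egf_euler0 big_ord0 expr0 mulr1 addr0.
rewrite mulrDr [X in X + _]mulrC !mulr_sumr !coefD !coef_sum; congr (_ + _).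
apply: eq_bigr => i _; have lt_ik := ltn_ord i.
have -> : (1 - 'X : {poly rat}) ^+ k = (1 - 'X) ^+ i * (1 - 'X) ^+ (k - i.+1).+1.
  by rewrite -exprD; congr (_ ^+ _); lia.
set E := (egf_euler i.+1)%:P; set B := powers_poly _; set P := (1 - 'X) ^+ i.
have -> : P * (1 - 'X) ^+ (k - i.+1).+1 * ('X * (E * B)) =
    'X * P * E * ((1 - 'X) ^+ (k - i.+1).+1 * B) by ring.
rewrite ['X * P * (E * _)]mulrA.
apply: (eq_coef_mul _ _ lt_mM) => j lt_jM.
by apply: IHk => //; lia.
Qed.

End PowersSeries.

(** * The quotient of power series *)

Lemma AhatE (n : nat) : Ahat n = 'X * (n`!%:R *: egf_alt_des n).
Proof.
rewrite /egf_alt_des scalerA divff ?fact_neq0 // scale1r mulr_sumr.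
by apply: eq_bigr => s _; rewrite exprS.
Qed.

Theorem theorem4p3 (n : nat) (hn : (1 <= n)%N) :
  fps_div (fps_of_poly (Ahat n)) (fps_of_poly ((1 - 'X) ^+ n.+1))
    =1 (fun m : nat => if (1 <= m)%N then (fhat n).[m%:R] else 0).
Proof.
move=> m; set P : {poly rat} := (1 - 'X) ^+ n.+1; set V := fps_of_poly P.
(* Only the coefficients of t^m and x^n are read, so truncation at orders m+1 and n+1 suffices. *)
pose W := \poly_(j < m.+1) fps_inv V j; pose B := powers_poly n.+1 m.+1 n.
have coef_mulW (p : {poly rat}) j : (j < m.+1)%N ->
    fps_mul (fps_of_poly p) (fps_inv V) j = (p * W)`_j.
  move=> lt_jm; rewrite /fps_mul coefM; apply: eq_bigr => i _.
  by rewrite coef_poly ifT //; lia.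
have V0 : V 0%N != 0.
  rewrite /V /fps_of_poly -horner_coef0 horner_exp hornerD hornerN hornerX.
  by rewrite hornerC subr0 expr1n oner_eq0.
have PW1 j : (j < m.+1)%N -> (P * W)`_j = (1 : {poly rat})`_j.
  by move=> lt_jm; rewrite -coef_mulW // fps_mulV.
have PB j : (j < m.+1)%N -> (P * B)`_j = (egf_alt_des n)`_j.
  exact: powers_poly_alt_des.
(* With D = [egf_alt_des n], up to order m: X D W = X W (P B) = X B (P W) = X B. *)
rewrite /fps_div coef_mulW // AhatE -scalerAr -scalerAl coefZ mulrAC.
rewrite -(eq_coef_mul ('X * W) PB) // [_ * (P * B)](_ : _ = 'X * B * (P * W));
  last by ring.
rewrite (eq_coef_mul ('X * B) PW1) // mulr1 coefXM horner_fhat.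
case: m @W @B {coef_mulW PW1 PB} => [|m] W B /=; first by rewrite mulr0.
by rewrite coef_poly ltnW // coef_euler_poly_exp.
Qed.
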